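(* Let $\mathcal{G}'$ be a finite simple undirected graph all of whose vertices have even degree. Then $\mathcal{G}'$ admits a swift phases configuration.
   Context: Let $\mathcal{G}'$ be a finite simple undirected graph with $N$ vertices and adjacency matrix $\mathbf{A}$. A chiral adjacency matrix on $\mathcal{G}'$ is an $N\times N$ hermitian matrix $\tilde{\mathbf{A}}$ such that $\tilde{\mathbf{A}}_{jk}$ is a complex number of modulus $1$ whenever $\mathbf{A}_{jk}=1$, and $\tilde{\mathbf{A}}_{jk}=0$ whenever $\mathbf{A}_{jk}=0$ (in particular the diagonal is zero). $\mathcal{G}'$ admits a swift phases configuration if there exists a chiral adjacency matrix $\tilde{\mathbf{A}}$ on $\mathcal{G}'$ such that $\tilde{\mathbf{A}}\,\mathbf{1}_N=0$, where $\mathbf{1}_N$ is the all-ones vector, i.e. such that each row of $\tilde{\mathbf{A}}$ sums to zero. *)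

(* Defs.v *)
From mathcomp Require Import all_boot all_order all_algebra.
From mathcomp Require Import complex reals.

Set Implicit Arguments.
Unset Strict Implicit.
Unset Printing Implicit Defensive.

Import Order.TTheory GRing.Theory Num.Theory.

Local Open Scope ring_scope.

(* A finite simple undirected graph on N labelled vertices is a symmetric
   irreflexive edge relation on 'I_N; these two properties are hypotheses
   wherever they are needed, not part of the definitions below. *)

Definition degree (N : nat) (e : rel 'I_N) (j : 'I_N) : nat :=
  #|[set k | e j k]|.

Definition adjmx (C : numClosedFieldType) (N : nat) (e : rel 'I_N) : 'M[C]_N :=
  \matrix_(j, k) (e j k)%:R.

Definition chiral_adjmx (C : numClosedFieldType) (N : nat) (e : rel 'I_N)
    (At : 'M[C]_N) : Prop :=
  [/\ At \is hermsymmx,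
      forall j k, adjmx C e j k = 1 -> `|At j k| = 1
    & forall j k, adjmx C e j k = 0 -> At j k = 0].

Definition swift_phases (C : numClosedFieldType) (N : nat) (e : rel 'I_N) :
    Prop :=
  exists2 At : 'M[C]_N,
    chiral_adjmx e At & At *m const_mx 1 = 0 :> 'cV[C]_N.

(* Main.v *)
(* Every row of a hermitian matrix i(B - B^T) sums to zero as soon as B is the
   adjacency matrix of an orientation of the graph whose in- and outdegrees
   agree.  Such an orientation is found, for multigraphs given as lists of
   pairs, by induction on the number of edges: if all degrees are even and
   ab is an edge that is not a loop, there is a second edge bc at b; replacing
   both by the single edge ac keeps degrees even, and an orientation of ac in
   the smaller multigraph lifts to one of the path abc. *)
Require Import Defs.
From mathcomp Require Import all_boot all_order all_algebra.
From mathcomp Require Import complex reals.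
From mathcomp Require Import zify.

Import Order.TTheory GRing.Theory Num.Theory.

Lemma count_fst {T : finType} (s : seq (T * T)) (x : T) :
  count (fun p => p.1 == x) s = \sum_y count_mem (x, y) s.
Proof.
elim: s => [|[a b] s IHs] /=; first by rewrite big1.
rewrite big_split /= -IHs; congr addn.
rewrite (bigD1 b) //= xpair_eqE eqxx andbT big1 ?addn0 // => y /negPf ny.
by rewrite xpair_eqE [b == y]eq_sym ny andbF.
Qed.

Lemma count_snd {T : finType} (s : seq (T * T)) (x : T) :
  count (fun p => p.2 == x) s = \sum_y count_mem (y, x) s.
Proof.
elim: s => [|[a b] s IHs] /=; first by rewrite big1.
rewrite big_split /= -IHs; congr addn.
rewrite (bigD1 a) //= xpair_eqE eqxx big1 ?addn0 // => y /negPf ny.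
by rewrite xpair_eqE [a == y]eq_sym ny.
Qed.

(** Insensitive to the direction of each pair. A loop at [x] counts twice in [edge_mult s x x], in
    keeping with its contribution of two to the degree. *)
Definition edge_mult {T : eqType} (s : seq (T * T)) (x y : T) : nat :=
  count_mem (x, y) s + count_mem (y, x) s.

Lemma edge_mult_cons {T : eqType} (a b : T) s x y :
  edge_mult ((a, b) :: s) x y =
  ((a == x) && (b == y)) + ((a == y) && (b == x)) + edge_mult s x y.
Proof. by rewrite /edge_mult /= !xpair_eqE addnACA. Qed.

Lemma perm_edge_mult {T : eqType} {s t : seq (T * T)} :
  perm_eq s t -> edge_mult s =2 edge_mult t.
Proof. by move=> /permP st x y; rewrite /edge_mult !st. Qed.

Definition mdeg {T : eqType} (s : seq (T * T)) (x : T) : nat :=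
  count (fun p => p.1 == x) s + count (fun p => p.2 == x) s.

Lemma mdeg_cons {T : eqType} (a b : T) s x :
  mdeg ((a, b) :: s) x = (a == x) + (b == x) + mdeg s x.
Proof. by rewrite /mdeg /= addnACA. Qed.

Lemma perm_mdeg {T : eqType} {s t : seq (T * T)} :
  perm_eq s t -> mdeg s =1 mdeg t.
Proof. by move=> /permP st x; rewrite /mdeg !st. Qed.

Lemma mdeg_edge_mult {T : finType} (s : seq (T * T)) (x : T) :
  mdeg s x = \sum_y edge_mult s x y.
Proof. by rewrite /mdeg count_fst count_snd -big_split. Qed.

Definition balanced {T : eqType} (t : seq (T * T)) : Prop :=
  forall x, count (fun p => p.1 == x) t = count (fun p => p.2 == x) t.

(** A pair incident to [b] may be stored with [b] second. Reversing it changes neither degrees nor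
    edge multiplicities, so [s] is recovered only up to these two data. *)
Lemma mdeg_gt0 {T : eqType} {s : seq (T * T)} {b : T} : 0 < mdeg s b ->
  exists c r, mdeg s =1 mdeg ((b, c) :: r) /\
    edge_mult s =2 edge_mult ((b, c) :: r) /\ size s = (size r).+1.
Proof.
rewrite addn_gt0 -!has_count => /orP[] /hasP[[u v] suv /eqP /= defb];
  have ps := perm_to_rem suv; rewrite -{}defb.
  exists v, (rem (u, v) s); split; first exact: perm_mdeg.
  by split; [exact: perm_edge_mult | rewrite (perm_size ps)].
exists u, (rem (u, v) s); split=> [x|].
  by rewrite (perm_mdeg ps) !mdeg_cons [X in X + _]addnC.
split=> [x y|]; last by rewrite (perm_size ps).
rewrite (perm_edge_mult ps) !edge_mult_cons; congr addn.
by rewrite addnC ![(v == _) && _]andbC.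
Qed.

Lemma mem_edge_mult {T : eqType} {t : seq (T * T)} {a c : T} :
  0 < edge_mult t a c -> (a, c) \in t \/ (c, a) \in t.
Proof. by rewrite addn_gt0 -!has_count !has_pred1 => /orP. Qed.

(** Loops and parallel edges have to be allowed for the induction: the new edge [ac] is a loop when
    [c = a], and may duplicate an existing edge. *)
Lemma even_balanced_orientation {T : eqType} (s : seq (T * T)) :
  (forall x, ~~ odd (mdeg s x)) ->
  exists2 t, edge_mult t =2 edge_mult s & balanced t.
Proof.
have [n] := ubnP (size s).
elim: n s => // n IHn [|[a b] s] /=; first by exists [::].
rewrite ltnS => sz ev.
have [eqab|neqab] := eqVneq a b.
  subst b; case: (IHn s sz) => [x|t ts bt].
    by have := ev x; rewrite mdeg_cons addnn oddD odd_double.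
  exists ((a, a) :: t) => [x y|x]; first by rewrite !edge_mult_cons ts.
  by rewrite /= bt.
(* The edge [ab] contributes exactly one to the even degree of [b], so the remaining edges
   contribute an odd number. *)
have /mdeg_gt0[c [r [dr [mr sr]]]] : 0 < mdeg s b.
  move: (ev b); rewrite mdeg_cons eqxx (negPf neqab).
  by case: (mdeg s b).
case: (IHn ((a, c) :: r)) => [|x|t tr bt].
- by rewrite /= -sr.
- have := ev x; rewrite !mdeg_cons dr mdeg_cons; move: (mdeg r x) => d.
  by rewrite !oddD; case: (b == x); case: (odd (a == x)); case: (odd (c == x));
    case: (odd d).
(* [t] traverses [ac] in one of the two directions; the detour through [b] follows the same
   direction, adding one entry and one exit at [b]. *)
have : 0 < edge_mult t a c by rewrite tr edge_mult_cons !eqxx.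
case/mem_edge_mult => /perm_to_rem pt.
  exists ((a, b) :: (b, c) :: rem (a, c) t) => [x y|x].
    move: (tr x y); rewrite (perm_edge_mult pt) !edge_mult_cons mr.
    by rewrite !edge_mult_cons; lia.
  by move: (bt x); rewrite !(permP pt) /=; lia.
exists ((c, b) :: (b, a) :: rem (c, a) t) => [x y|x].
  move: (tr x y); rewrite (perm_edge_mult pt) !edge_mult_cons mr.
  by rewrite !edge_mult_cons; lia.
by move: (bt x); rewrite !(permP pt) /=; lia.
Qed.

Lemma edge_list {N : nat} (e : rel 'I_N) :
  symmetric e -> irreflexive e ->
  exists s, forall j k, edge_mult s j k = e j k.
Proof.
move=> e_sym e_irr.
(* The order on ['I_N] selects one of the two pairs of each edge. *)
exists (enum [set p : 'I_N * 'I_N | (p.1 < p.2) && e p.1 p.2]) => j k.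
rewrite /edge_mult !count_uniq_mem ?enum_uniq // !mem_enum !inE /= [e k j]e_sym.
by case: (ltngtP j k) => [_|_|/val_inj ->]; rewrite /= ?addn0 ?e_irr.
Qed.

Local Open Scope ring_scope.

Lemma even_swift_phases (C : numClosedFieldType) {N : nat} (e : rel 'I_N) :
  symmetric e -> irreflexive e -> (forall j, ~~ odd (degree e j)) ->
  swift_phases C e.
Proof.
move=> e_sym e_irr e_even.
have [s es] := edge_list e e_sym e_irr.
have [x|t ts bt] := even_balanced_orientation s.
  have := e_even x; rewrite mdeg_edge_mult (eq_bigr _ (fun y _ => es x y)).
  by rewrite /degree cardsE -sum1_card big_mkcond.
pose d (j k : 'I_N) : C :=
  (count_mem (j, k) t)%:R - (count_mem (k, j) t)%:R.
(* The graph is simple, so on an edge exactly one of the two counts is 1 and [d j k] is 1 or -1; off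
   the edges both vanish. *)
have te j k : (count_mem (j, k) t + count_mem (k, j) t)%N = e j k.
  by rewrite -es -ts.
exists (\matrix_(j, k) ('i * d j k)); first split.
- apply/is_hermitianmxP; rewrite expr0 scale1r; apply/matrixP => j k.
  by rewrite !mxE rmorphM rmorphB /= conjCi !conjC_nat mulNr -mulrN opprB.
- move=> j k; rewrite !mxE normrM normCi mul1r /d.
  have := te j k; case: (e j k) => [|_ /eqP]; last by rewrite eq_sym oner_eq0.
  case: (count_mem (j, k) t) => [|[|//]] /=.
    by rewrite add0n => -> _; rewrite sub0r normrN normr1.
  by case: (count_mem _ _) => // _ _; rewrite subr0 normr1.
- move=> j k; rewrite !mxE /d.
  have := te j k; case: (e j k) => [_ /eqP|]; first by rewrite oner_eq0.
  by move/eqP; rewrite addn_eq0 => /andP[/eqP-> /eqP->] _; rewrite subrr mulr0.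
apply/matrixP => j k; rewrite !mxE.
under eq_bigr do rewrite !mxE mulr1.
(* The row sum is ['i] times outdegree minus indegree of [j] in [t]. *)
by rewrite -mulr_sumr sumrB -!natr_sum -count_fst -count_snd bt subrr mulr0.
Qed.

Theorem theorem2 (R : realType) (N : nat) (e : rel 'I_N)
    (e_sym : symmetric e) (e_irr : irreflexive e)
    (e_even : forall j : 'I_N, ~~ odd (degree e j)) :
  swift_phases (complex R) e.
Proof. exact: even_swift_phases. Qed.
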